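(* Let $K=\mathbf{C}$, let $\mathcal{N}\subset K^{n\times n}$ be the variety of nilpotent $n\times n$ matrices, and let $B\subset \mathrm{GL}_n(K)$ be the standard Borel subgroup of invertible upper-triangular matrices, acting on $\mathcal{N}$ by conjugation. Then the affine space $$\mathcal{H}_B:=\{H\in\mathcal{N}\mid H_{i,j}=0 \text{ for } i\le j;\ H_{i+1,i}=1 \text{ for all } i\in\{1,\dots,n-1\}\}$$ is a generic normal form for the $B$-action on $\mathcal{N}$.
   Context: Let $G$ be an algebraic group acting on an affine variety $X$. A subset $X_0\subseteq X$ is called a generic normal form if (1) $G.X_0\subseteq X$ is open, and (2) $G.x\ne G.x'$ for all $x,x'\in X_0$ with $x\neq x'$. Openness is in the Zariski topology. *)

(* Defs.v *)
From HB Require Import structures.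
From mathcomp Require Import all_boot all_order all_algebra.
From mathcomp Require Import boolp classical_sets reals.
From mathcomp Require Import complex mpoly.

Set Implicit Arguments.
Unset Strict Implicit.
Unset Printing Implicit Defensive.

Import GRing.Theory.
Local Open Scope ring_scope.
Local Open Scope classical_set_scope.

Section AlgebraicGeometry.
Variable K : closedFieldType.

(* The affine space of p x q matrices is identified with K^(p * q) through
   mxvec; polynomial functions on it are elements of {mpoly K[p * q]}. *)
Definition mx_coords p q (A : 'M[K]_(p, q)) : 'I_(p * q) -> K :=
  fun k => mxvec A 0 k.

Definition zariski_closed p q (Z : set 'M[K]_(p, q)) : Prop :=
  exists P : set {mpoly K[p * q]},
    Z = [set A | forall f, P f -> f.@[mx_coords A] = 0].

(* Zariski topology induced on a subset X. *)
Definition closed_in p q (X S : set 'M[K]_(p, q)) : Prop :=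
  exists2 Z, zariski_closed Z & S = X `&` Z.

Definition open_in p q (X U : set 'M[K]_(p, q)) : Prop :=
  exists2 Z, zariski_closed Z & U = X `\` Z.

(* Varieties are not assumed irreducible. *)
Record affine_variety p q := AffineVariety {
  points :> set 'M[K]_(p, q);
  points_closed : zariski_closed points
}.

Definition GL n : set 'M[K]_n := [set g | g \in unitmx].
Arguments GL n : clear implicits.

(* Every affine algebraic group is a Zariski-closed subgroup of some GL_n. *)
Record algebraic_group n := AlgebraicGroup {
  gpoints :> set 'M[K]_n;
  gpoints_GL : gpoints `<=` GL n;
  gpoints_closed : closed_in (GL n) gpoints;
  gpoints1 : gpoints 1%:M;
  gpointsM : forall g h, gpoints g -> gpoints h -> gpoints (g *m h);
  gpointsV : forall g, gpoints g -> gpoints (invmx g)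
}.

(* Regular functions on a closed subset of GL_n x 'M_(p, q) are the polynomials
   in the entries of g, of g^-1 and of x. *)
Definition action_coords n p q (g : 'M[K]_n) (x : 'M[K]_(p, q)) :
    'I_(n * n + n * n + p * q) -> K :=
  fun k => row_mx (row_mx (mxvec g) (mxvec (invmx g))) (mxvec x) 0 k.

Record algebraic_action n p q
    (G : algebraic_group n) (X : affine_variety p q) := AlgebraicAction {
  act :> 'M[K]_n -> 'M[K]_(p, q) -> 'M[K]_(p, q);
  act_stable : forall g x, gpoints G g -> points X x -> points X (act g x);
  act1 : forall x, points X x -> act 1%:M x = x;
  actM : forall g h x, gpoints G g -> gpoints G h -> points X x ->
    act (g *m h) x = act g (act h x);
  act_regular : forall i j,
    exists f : {mpoly K[n * n + n * n + p * q]},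
      forall g x, gpoints G g -> points X x ->
        act g x i j = f.@[action_coords g x]
}.

Definition orbit n p q (G : algebraic_group n) (X : affine_variety p q)
    (a : algebraic_action G X) (x : 'M[K]_(p, q)) : set 'M[K]_(p, q) :=
  [set a g x | g in gpoints G].

Definition saturation n p q (G : algebraic_group n) (X : affine_variety p q)
    (a : algebraic_action G X) (X0 : set 'M[K]_(p, q)) : set 'M[K]_(p, q) :=
  \bigcup_(x in X0) orbit a x.

Definition generic_normal_form n p q
    (G : algebraic_group n) (X : affine_variety p q)
    (a : algebraic_action G X) (X0 : set 'M[K]_(p, q)) : Prop :=
  [/\ X0 `<=` points X,
      open_in (points X) (saturation a X0) &
      forall x x', X0 x -> X0 x' -> x <> x' -> orbit a x <> orbit a x'].

Definition affine_space p q (S : set 'M[K]_(p, q)) : Prop :=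
  exists (x0 : 'M[K]_(p, q)) (W : {vspace 'M[K]_(p, q)}),
    S = [set x | x - x0 \in W].

End AlgebraicGeometry.
Arguments GL K n : clear implicits.

Lemma expmx_eq0 (K : fieldType) n (A : 'M[K]_n) k : A ^+ k = 0 -> A ^+ n = 0.
Proof.
case: n A => [|m] A Ak0; first by rewrite [LHS]thinmx0 [RHS]thinmx0.
have min0 : mxminpoly A %| 'X^k.
  by apply: mxminpoly_min; rewrite rmorphXn /= horner_mx_X.
have [l _] : exists2 l, (l <= k)%N & mxminpoly A %= ('X - 0%:P) ^+ l.
  by apply/dvdp_exp_XsubCP; rewrite subr0.
rewrite subr0 => minE.
have lem : (l <= m.+1)%N.
  have := dvdp_leq (monic_neq0 (char_poly_monic A)) (mxminpoly_dvd_char A).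
  by rewrite (eqp_size minE) size_polyXn size_char_poly.
have Al0 : A ^+ l = 0.
  have : horner_mx A 'X^l = 0.
    by apply/mxminpoly_minP; rewrite (eqp_dvdl _ minE).
  by rewrite rmorphXn /= horner_mx_X.
have -> : A ^+ m.+1 = A ^+ (m.+1 - l) * A ^+ l by rewrite -exprD subnK.
by rewrite Al0 mulr0.
Qed.

Section BorelConjugation.
Variables (K : closedFieldType) (n : nat).

Definition nilpotent (A : 'M[K]_n) : Prop := exists k : nat, A ^+ k = 0.

Definition upper_triangular (A : 'M[K]_n) : Prop :=
  forall i j : 'I_n, (j < i)%N -> A i j = 0.

Lemma nilpotentP (A : 'M[K]_n) : nilpotent A <-> A ^+ n = 0.
Proof. by split=> [[k /expmx_eq0]|]; last exists n. Qed.

Definition generic_mx : 'M[{mpoly K[n * n]}]_n :=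
  \matrix_(i, j) 'X_(mxvec_index i j).

Lemma meval_generic_mx (A : 'M[K]_n) :
  map_mx (meval (mx_coords A)) generic_mx = A.
Proof. by apply/matrixP=> i j; rewrite !mxE mevalXU /mx_coords mxvecE. Qed.

Lemma nilpotent_closed : zariski_closed [set A | nilpotent A].
Proof.
exists [set f | exists i j, f = (generic_mx ^+ n) i j].
have E (A : 'M[K]_n) i j :
    ((generic_mx ^+ n) i j).@[mx_coords A] = (A ^+ n) i j.
  transitivity (map_mx (meval (mx_coords A)) (generic_mx ^+ n) i j).
    by rewrite mxE.
  by rewrite rmorphXn /= meval_generic_mx.
apply/seteqP; split=> A /=.
  by move=> /nilpotentP A0 _ [i [j ->]]; rewrite E A0 mxE.
move=> A0; apply/nilpotentP/matrixP => i j.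
by rewrite -E A0 ?mxE //; exists i, j.
Qed.

Definition nilpotent_variety : affine_variety K n n :=
  AffineVariety nilpotent_closed.

Definition borel_set : set 'M[K]_n :=
  [set g | g \in unitmx /\ upper_triangular g].

Lemma borel_GL : borel_set `<=` GL K n.
Proof. by move=> g []. Qed.

Lemma borel_closed : closed_in (GL K n) borel_set.
Proof.
exists [set g | upper_triangular g]; last by [].
exists [set f | exists i j : 'I_n, (j < i)%N /\ f = generic_mx i j].
have E (A : 'M[K]_n) i j : (generic_mx i j).@[mx_coords A] = A i j.
  by rewrite -[in RHS](meval_generic_mx A) [RHS]mxE.
apply/seteqP; split=> A /=.
  by move=> Au _ [i [j [lt_ji ->]]]; rewrite E Au.
by move=> A0 i j lt_ji; rewrite -E A0 //; exists i, j.
Qed.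

Lemma borel1 : borel_set 1%:M.
Proof.
split; first exact: unitmx1.
by move=> i j lt_ji; rewrite mxE -val_eqE /= gtn_eqF.
Qed.

Lemma borelM g h : borel_set g -> borel_set h -> borel_set (g *m h).
Proof.
move=> [gU gT] [hU hT]; split; first by rewrite unitmx_mul gU.
move=> i j lt_ji; rewrite mxE big1 // => k _.
have [lt_ki|le_ik] := ltnP k i; first by rewrite gT ?mul0r.
by rewrite hT ?mulr0 // (leq_trans lt_ji).
Qed.

Lemma borelV g : borel_set g -> borel_set (invmx g).
Proof.
move=> [gU gT]; split; first by rewrite unitmx_inv.
have gii i : g i i != 0.
  have : \det g^T \is a GRing.unit by rewrite det_tr.
  rewrite det_trig; last first.
    by apply/is_trig_mxP => a b lt_ab; rewrite mxE gT.
  rewrite unitfE => /prodf_neq0/(_ i isT).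
  by rewrite mxE.
move=> i j; move: i.
suff H m : forall i : 'I_n, (j < i)%N -> (n - i <= m)%N -> invmx g i j = 0.
  by move=> i ij; apply: (H n) => //; apply: leq_subr.
elim: m => [|m IHm] i lt_ji le_m.
  by move: le_m; rewrite leqn0 subn_eq0 leqNgt ltn_ord.
have /matrixP/(_ i j) := mulmxV gU.
rewrite !mxE -val_eqE /= gtn_eqF // (bigD1 i) //= big1 => [|k ki].
  by rewrite addr0 => /eqP; rewrite mulf_eq0 (negPf (gii i)) /= => /eqP.
case: (ltngtP k i) => [lt_ki|lt_ik|/val_inj E].
- by rewrite gT ?mul0r.
- rewrite IHm ?mulr0 //; first exact: ltn_trans lt_ik.
  have := ltn_sub2l (ltn_ord i) lt_ik.
  by move=> /leq_trans /(_ le_m); rewrite ltnS.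
- by rewrite E eqxx in ki.
Qed.

Definition borel : algebraic_group K n :=
  AlgebraicGroup borel_GL borel_closed borel1 borelM borelV.

Definition conj_act (g A : 'M[K]_n) : 'M[K]_n := g *m A *m invmx g.

Lemma conj_act_stable g A : gpoints borel g -> points nilpotent_variety A ->
  points nilpotent_variety (conj_act g A).
Proof.
move=> [gU _] [k Ak0]; exists k.
have -> : conj_act g A ^+ k = conj_act g (A ^+ k).
  rewrite /conj_act; elim: k {Ak0} => [|k IHk].
    by rewrite !expr0 mulmx1 mulmxV.
  rewrite !exprS IHk -![_ * _]/(_ *m _) !mulmxA.
  by rewrite -(mulmxA _ (invmx g) g) mulVmx // mulmx1.
by rewrite /conj_act Ak0 mulmx0 mul0mx.
Qed.

Lemma conj_act1 A : points nilpotent_variety A -> conj_act 1%:M A = A.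
Proof. by move=> _; rewrite /conj_act invmx1 mulmx1 mul1mx. Qed.

Lemma conj_actM g h A :
  gpoints borel g -> gpoints borel h -> points nilpotent_variety A ->
  conj_act (g *m h) A = conj_act g (conj_act h A).
Proof.
move=> [gU _] [hU _] _; rewrite /conj_act.
have -> : invmx (g *m h) = invmx h *m invmx g.
  have ghU : g *m h \in unitmx by rewrite unitmx_mul gU.
  rewrite -[RHS]mulmx1 -(mulmxV ghU) !mulmxA.
  by rewrite -(mulmxA _ (invmx g) g) mulVmx // mulmx1 mulVmx // mul1mx.
by rewrite !mulmxA.
Qed.

Lemma conj_act_regular i j :
  exists f : {mpoly K[n * n + n * n + n * n]},
    forall g A, gpoints borel g -> points nilpotent_variety A ->
      conj_act g A i j = f.@[action_coords g A].
Proof.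
exists (\sum_l (\sum_k 'X_(lshift _ (lshift _ (mxvec_index i k))) *
                       'X_(rshift _ (mxvec_index k l))) *
               'X_(lshift _ (rshift _ (mxvec_index l j)))).
move=> g A _ _; rewrite /conj_act !mxE rmorph_sum /=.
apply: eq_bigr => l _; rewrite rmorphM rmorph_sum /= mxE.
congr (_ * _); last first.
  by rewrite mevalXU /action_coords row_mxEl row_mxEr mxvecE.
apply: eq_bigr => k _; rewrite rmorphM /= !mevalXU.
by rewrite /action_coords row_mxEl row_mxEl row_mxEr !mxvecE.
Qed.

Definition borel_conj : algebraic_action borel nilpotent_variety :=
  AlgebraicAction conj_act_stable conj_act1 conj_actM conj_act_regular.

Definition H_B : set 'M[K]_n :=
  [set H | [/\ points nilpotent_variety H,
               forall i j : 'I_n, (i <= j)%N -> H i j = 0 &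
               forall i j : 'I_n, i = j.+1 :> nat -> H i j = 1]].

End BorelConjugation.

Arguments nilpotent_variety K n : clear implicits.
Arguments borel K n : clear implicits.
Arguments borel_conj K n : clear implicits.
Arguments H_B K n : clear implicits.

(* Main.v *)
From HB Require Import structures.
Require Import Defs.
From mathcomp Require Import all_boot all_order all_algebra.
From mathcomp Require Import boolp classical_sets reals.
From mathcomp Require Import complex mpoly.
Local Open Scope ring_scope.

(** The whole argument reads off the normal form of a nilpotent matrix A from
    its Krylov matrix k(A), whose columns are e_0, A e_0, ..., A^(n-1) e_0,
    where e_0 is the first basis vector.

    - An invertible upper triangular g has e_0 as an eigenvector, so that
      k(g A g^-1) = c g k(A) for a nonzero scalar c ([krylov_conj]).
    - If H is in H_B, then k(H) is lower triangular with ones on the diagonal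
      ([krylov_lower_subdiag1]): H moves e_j to e_(j+1) plus later vectors.
    - If A is nilpotent, then A k(A) = k(A) J, where J is the nilpotent Jordan
      block with ones below the diagonal ([mulmx_krylov]).

    Openness. A matrix is a product U L with U invertible upper triangular and L
    lower unitriangular exactly when its trailing principal minors are all
    nonzero ([UL_decomposition], [trailing_minors_UL]). By the first two facts,
    every A in the saturation of H_B has such a k(A). Conversely, if A is
    nilpotent and k(A) = U L, then the third fact gives
    U^-1 A U = L J L^-1, which lies in H_B. Hence the saturation is cut out of
    the nilpotent variety by the nonvanishing of a single polynomial in the
    entries of A, the product of the trailing minors of k(A)
    ([H_B_saturationP]).

    Separation of orbits. If H' = g H g^-1 with H and H' in H_B, then
    c g = k(H') k(H)^-1 is both upper triangular and lower unitriangular, hence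
    the identity; so g is scalar and H' = H ([borel_conj_subdiag1_inj]).

    Finally, a strictly lower triangular matrix is nilpotent, so that H_B is
    defined by affine linear equations alone ([H_B_affine_space]). *)

Import GRing.Theory.

(** * Trailing minors and UL decomposition *)

Section TrailingMinors.
Set Implicit Arguments.
Unset Strict Implicit.

(** A product is used, rather than a family of conditions, so that the open
    set obtained is the complement of one hypersurface; the recursion on the
    lower right block matches the induction in both directions of the UL
    criterion. *)
Fixpoint trailing_minors (R : comPzRingType) n : 'M[R]_n -> R :=
  match n return 'M[R]_n -> R with
  | 0 => fun=> 1
  | m.+1 => fun M => \det M * trailing_minors (@drsubmx R 1 m 1 m M)
  end.

(** Applied to evaluation of polynomials: it makes the trailing minors of a
    matrix of polynomials into polynomial functions. *)
Lemma map_trailing_minors (R S : comNzRingType) (f : {rmorphism R -> S}) n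
    (M : 'M[R]_n) :
  trailing_minors (map_mx f M) = f (trailing_minors M).
Proof.
elim: n M => [|m IHm] M /=; first by rewrite rmorph1.
by rewrite rmorphM det_map_mx -map_drsubmx IHm.
Qed.

Variable K : closedFieldType.

(** Triangularity is put on the transpose so that the closure properties of the
    Borel subgroup transfer to lower triangular matrices. *)
Definition lower_unitriangular n (L : 'M[K]_n) : Prop :=
  upper_triangular L^T /\ forall i, L i i = 1.

Lemma lower_entry0 n (L : 'M[K]_n) (i j : 'I_n) :
  lower_unitriangular L -> (i < j)%N -> L i j = 0.
Proof. by case=> Ll _ /Ll; rewrite mxE. Qed.

Lemma upper_triangularP n (U : 'M[K]_n) :
  upper_triangular U <-> is_trig_mx U^T.
Proof.
split=> [Uu|/is_trig_mxP Ut i j lt_ji]; last by rewrite -(Ut j i lt_ji) mxE.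
by apply/is_trig_mxP => i j lt_ij; rewrite mxE Uu.
Qed.

Lemma det_upper n (U : 'M[K]_n) : upper_triangular U ->
  \det U = \prod_i U i i.
Proof.
move=> /upper_triangularP Uu; rewrite -det_tr det_trig //.
by apply: eq_bigr => i _; rewrite mxE.
Qed.

Lemma lower_unitriangular_borel n (L : 'M[K]_n) :
  lower_unitriangular L -> borel_set L^T.
Proof.
move=> [Ll L1]; split=> //.
rewrite unitmxE (det_upper Ll) big1 ?unitr1 // => i _.
by rewrite mxE L1.
Qed.

Lemma lower_unitriangular_unit n (L : 'M[K]_n) :
  lower_unitriangular L -> L \in unitmx.
Proof. by move=> /lower_unitriangular_borel[]; rewrite unitmx_tr. Qed.

Lemma diag_mulmx_upper n (A B : 'M[K]_n) i : upper_triangular A ->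
  upper_triangular B -> (A *m B) i i = A i i * B i i.
Proof.
move=> Au Bu; rewrite mxE (bigD1 i) //= big1 ?addr0 // => k ki.
case: (ltngtP k i) => [lt_ki|lt_ik|/val_inj E].
- by rewrite Au ?mul0r.
- by rewrite Bu ?mulr0.
- by rewrite E eqxx in ki.
Qed.

Lemma lower_unitriangularV n (L : 'M[K]_n) :
  lower_unitriangular L -> lower_unitriangular (invmx L).
Proof.
move=> LT; have LU := lower_unitriangular_unit LT; have [Ll L1] := LT.
have [_ Vl] := borelV (lower_unitriangular_borel LT).
rewrite -trmx_inv in Vl; split=> // i.
have : ((invmx L)^T *m L^T) i i = 1 by rewrite -trmx_mul mulmxV // !mxE eqxx.
by rewrite diag_mulmx_upper // !mxE L1 mulr1.
Qed.

Lemma lower_unitriangularM n (L M : 'M[K]_n) : lower_unitriangular L ->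
  lower_unitriangular M -> lower_unitriangular (L *m M).
Proof.
move=> LT MT; have [_ LMl] :=
  borelM (lower_unitriangular_borel MT) (lower_unitriangular_borel LT).
rewrite -trmx_mul in LMl; split=> // i.
have -> : (L *m M) i i = (M^T *m L^T) i i by rewrite -trmx_mul [RHS]mxE.
rewrite diag_mulmx_upper; [|exact: MT.1|exact: LT.1].
by rewrite !mxE LT.2 MT.2 mulr1.
Qed.

Lemma upper_lower_unitriangular n (T : 'M[K]_n) :
  upper_triangular T -> lower_unitriangular T -> T = 1%:M.
Proof.
move=> Tu Tl; apply/matrixP => i j; rewrite mxE -val_eqE.
case: ltngtP => [lt_ij|lt_ji|/val_inj ->]; last exact: Tl.2.
- exact: lower_entry0.
- exact: Tu.
Qed.

Lemma borel_diag_neq0 n (g : 'M[K]_n) i : borel_set g -> g i i != 0.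
Proof.
move=> [gU gu]; move: gU; rewrite unitmxE det_upper // unitfE => /prodf_neq0.
by apply.
Qed.

Lemma borelZ n c (g : 'M[K]_n) : c != 0 -> borel_set g -> borel_set (c *: g).
Proof.
move=> c0 [gU gu]; split=> [|i j lt_ji]; last by rewrite mxE gu ?mulr0.
by rewrite unitmxZ ?unitfE.
Qed.

Lemma upper_triangular_block m (u : 'M[K]_1) (v : 'rV[K]_m) (U : 'M[K]_m) :
  upper_triangular U -> upper_triangular (@block_mx K 1 m 1 m u v 0 U).
Proof.
move=> Uu; apply/upper_triangularP.
rewrite (@tr_block_mx K 1 m 1 m) (@is_trig_block_mx K 1 m 1 m) // trmx0 eqxx.
by rewrite mx11_is_trig; apply/upper_triangularP.
Qed.

(** Split off the first row and column, M = (a, b; c, D). Induction writes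
    D = U L, and then M = (u, v; 0, U) (1, 0; l, L) is solved by
    v = b L^-1, l = U^-1 c, u = a - v l. The factor (u, v; 0, U) is invertible
    because M is. *)
Lemma UL_decomposition n (M : 'M[K]_n) : trailing_minors M != 0 ->
  exists U L : 'M[K]_n,
    [/\ borel_set U, lower_unitriangular L & M = U *m L].
Proof.
elim: n M => [|m IHm] M /=.
  move=> _; exists 1%:M, 1%:M; split; first exact: borel1.
    by split=> [] [].
  by rewrite [LHS]thinmx0 [RHS]thinmx0.
have [a [b [c [D ->]]]] : exists a b c D, M = @block_mx K 1 m 1 m a b c D.
  by do 4!eexists; exact: esym (@submxK K 1 m 1 m M).
rewrite block_mxKdr mulf_eq0 negb_or => /andP[detM /IHm[U [L [[UU Uu] LT eD]]]].
have LU := lower_unitriangular_unit LT.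
pose v := b *m invmx L; pose l := invmx U *m c; pose u := a - v *m l.
pose U' : 'M_m.+1 := @block_mx K 1 m 1 m u v 0 U.
pose L' : 'M_m.+1 := @block_mx K 1 m 1 m 1%:M 0 l L.
have eqM : block_mx a b c D = U' *m L'.
  rewrite (@mulmx_block K 1 m 1 m 1 m) !mulmx0 !mulmx1 !add0r /u subrK.
  by rewrite mulmxKV // mulKVmx // eD.
exists U', L'; split=> //.
- split.
    move: detM; rewrite eqM det_mulmx mulf_eq0 negb_or => /andP[detU _].
    by rewrite unitmxE unitfE.
  exact: upper_triangular_block.
- split.
    apply/upper_triangularP; rewrite trmxK (@is_trig_block_mx K 1 m 1 m) //.
    by rewrite eqxx mx11_is_trig -[L]trmxK; apply/upper_triangularP/LT.1.
  move=> i; rewrite /L'; case: (@split_ordP 1 m i) => k ->.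
    by rewrite (@block_mxEul K 1 m 1 m) mxE eqxx.
  by rewrite (@block_mxEdr K 1 m 1 m) LT.2.
Qed.

(** The lower right block of U L is the product of the lower right blocks of U
    and L, because the lower left block of U vanishes. *)
Lemma trailing_minors_UL n (U L : 'M[K]_n) :
  borel_set U -> lower_unitriangular L -> trailing_minors (U *m L) != 0.
Proof.
elim: n U L => [|m IHm] U L; first by rewrite oner_eq0.
move=> [UU Uu] LT; have LU := lower_unitriangular_unit LT.
rewrite /= mulf_neq0 //; first by rewrite -unitfE -unitmxE unitmx_mul UU.
have := UU; rewrite unitmxE det_upper //.
have [u [v [w [U' eU]]]] : exists a b c D, U = @block_mx K 1 m 1 m a b c D.
  by do 4!eexists; exact: esym (@submxK K 1 m 1 m U).
have w0 : w = 0.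
  apply/matrixP => i j; rewrite [RHS]mxE.
  by rewrite -(@block_mxEdl K 1 m 1 m u v w U') -eU Uu // (ord1 j).
have U'u : upper_triangular U'.
  move=> i j lt_ji.
  by rewrite -(@block_mxEdr K 1 m 1 m u v w U') -eU Uu.
have [a [b [c [L' eL]]]] : exists a b c D, L = @block_mx K 1 m 1 m a b c D.
  by do 4!eexists; exact: esym (@submxK K 1 m 1 m L).
rewrite unitfE => /prodf_neq0 Ud.
rewrite eU eL w0 (@mulmx_block K 1 m 1 m 1 m) block_mxKdr mul0mx add0r.
apply: IHm.
  split=> //; rewrite unitmxE unitfE det_upper //; apply/prodf_neq0 => i _.
  by have := Ud (@rshift 1 m i) isT; rewrite eU (@block_mxEdr K 1 m 1 m).
split=> [i j lt_ji|i].
  by rewrite mxE -(@block_mxEdr K 1 m 1 m a b c L') -eL lower_entry0.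
by rewrite -(@block_mxEdr K 1 m 1 m a b c L') -eL LT.2.
Qed.

End TrailingMinors.

(** * Krylov matrices *)

Section Krylov.
Set Implicit Arguments.
Unset Strict Implicit.

Definition krylov (R : comNzRingType) m (A : 'M[R]_m.+1) : 'M[R]_m.+1 :=
  \matrix_(i, j) (A ^+ j) i 0.

Lemma map_krylov (R S : comNzRingType) (f : {rmorphism R -> S}) m
    (A : 'M[R]_m.+1) : krylov (map_mx f A) = map_mx f (krylov A).
Proof. by apply/matrixP => i j; rewrite !mxE -rmorphXn mxE. Qed.

Variable (K : closedFieldType) (m : nat).
Implicit Types A g : 'M[K]_m.+1.

Definition shift_mx n : 'M[K]_n := \matrix_(i, j) (i == j.+1 :> nat)%:R.

Lemma mulmx_shiftE n (B : 'M[K]_n) (i j k : 'I_n) : k = j.+1 :> nat ->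
  (B *m shift_mx n) i j = B i k.
Proof.
move=> kj; rewrite mxE (bigD1 k) //= big1 => [|l lk].
  by rewrite mxE kj eqxx mulr1 addr0.
by rewrite mxE -kj val_eqE (negPf lk) mulr0.
Qed.

Lemma mulmx_shift_last n (B : 'M[K]_n) (i j : 'I_n) : (n <= j.+1)%N ->
  (B *m shift_mx n) i j = 0.
Proof.
move=> lenj; rewrite mxE big1 // => l _.
by rewrite mxE (ltn_eqF (leq_trans (ltn_ord l) lenj)) mulr0.
Qed.

(** Multiplication by A moves every column of the Krylov matrix one place to
    the left; nilpotency says that the column A^n e_0 entering on the right is
    zero. *)
Lemma mulmx_krylov A : A ^+ m.+1 = 0 ->
  A *m krylov A = krylov A *m shift_mx m.+1.
Proof.
move=> A0; apply/matrixP => i j.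
have -> : (A *m krylov A) i j = (A ^+ j.+1) i 0.
  by rewrite exprS !mxE; apply: eq_bigr => k _; rewrite mxE.
have [lt_j|ge_j] := ltnP j.+1 m.+1.
  by rewrite (@mulmx_shiftE _ _ i j (Ordinal lt_j)) // mxE.
rewrite mulmx_shift_last //; have -> : j.+1 = m.+1.
  by apply/anti_leq; rewrite ge_j ltn_ord.
by rewrite A0 mxE.
Qed.

(** The inverse of g maps e_0 to a multiple of itself, so the j-th column
    g A^j g^-1 e_0 is that multiple of g A^j e_0. *)
Lemma krylov_conj g A : borel_set g ->
  krylov (conj_act g A) = invmx g 0 0 *: (g *m krylov A).
Proof.
move=> gB; have [gU _] := gB; have [_ Vu] := borelV gB.
apply/matrixP => i j; rewrite !mxE.
have -> : conj_act g A ^+ j = g *m A ^+ j *m invmx g.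
  elim: (nat_of_ord j) => [|k IHk]; first by rewrite !expr0 mulmx1 mulmxV.
  rewrite !exprS IHk /conj_act -![_ * _]/(_ *m _) !mulmxA.
  by rewrite -(mulmxA _ (invmx g) g) mulVmx // mulmx1.
(* Only the diagonal entry of the first column of [invmx g] survives. *)
rewrite mxE (bigD1 0) //= big1 => [|k k0]; last first.
  by rewrite Vu ?mulr0 // lt0n.
rewrite addr0 mulrC mxE; congr (_ * _); apply: eq_bigr => k _.
by rewrite mxE.
Qed.

End Krylov.

(** * The normal form *)

Section NormalForm.
Local Open Scope classical_set_scope.
Set Implicit Arguments.
Unset Strict Implicit.
Variable K : closedFieldType.

Definition lower_subdiag1 n (H : 'M[K]_n) : Prop :=
  (forall i j : 'I_n, (i <= j)%N -> H i j = 0) /\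
  (forall i j : 'I_n, i = j.+1 :> nat -> H i j = 1).

(** By induction on k, the vector H^k e_0 has zeros above position k and a one
    at position k. *)
Lemma krylov_lower_subdiag1 m (H : 'M[K]_m.+1) :
  lower_subdiag1 H -> lower_unitriangular (krylov H).
Proof.
move=> [H0 H1].
have P k : (forall i : 'I_m.+1, (i < k)%N -> (H ^+ k) i 0 = 0) /\
           (forall i : 'I_m.+1, i = k :> nat -> (H ^+ k) i 0 = 1).
  elim: k => [|k [IH0 IH1]].
    split=> [//|i i0]; rewrite expr0 mxE (_ : i = 0) ?eqxx //.
    exact: val_inj.
  split=> i ik; rewrite exprS mxE.
    rewrite big1 // => l _; have [le_il|lt_li] := leqP i l.
      by rewrite H0 ?mul0r.
    by rewrite IH0 ?mulr0 // (leq_trans lt_li).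
  have lt_k : (k < m.+1)%N by apply: ltnW; rewrite -ik.
  rewrite (bigD1 (Ordinal lt_k)) //= big1 => [|l]; last first.
    rewrite -val_eqE /= => neq_lk; have [le_il|lt_li] := leqP i l.
      by rewrite H0 ?mul0r.
    rewrite IH0 ?mulr0 // ltn_neqAle neq_lk /=.
    by rewrite ik ltnS in lt_li.
  by rewrite H1 // IH1 // mulr1 addr0.
split=> [i j lt_ji|i]; rewrite !mxE; first exact: (P i).1.
exact: (P i).2.
Qed.

(** Right multiplication by the Jordan block moves the unit diagonal of L to the
    subdiagonal, and multiplying by the lower unitriangular inverse of L keeps
    this shape. *)
Lemma lower_subdiag1_conj_shift n (L : 'M[K]_n) :
  lower_unitriangular L -> lower_subdiag1 (L *m shift_mx K n *m invmx L).
Proof.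
move=> LT; have VT := lower_unitriangularV LT.
set T := invmx L in VT *; set B := L *m _.
have B0 (i j : 'I_n) : (i <= j)%N -> B i j = 0.
  move=> le_ij; have [lt_j|ge_j] := ltnP j.+1 n; last exact: mulmx_shift_last.
  by rewrite (@mulmx_shiftE _ _ _ i j (Ordinal lt_j)) // lower_entry0.
split=> i j ij; rewrite mxE.
  rewrite big1 // => l _; have [le_il|lt_li] := leqP i l.
    by rewrite B0 ?mul0r.
  by rewrite (lower_entry0 VT) ?mulr0 // (leq_trans lt_li).
rewrite (bigD1 j) //= big1 => [|l lj].
  by rewrite (@mulmx_shiftE _ _ _ i j i) // LT.2 VT.2 mulr1 addr0.
have [le_il|lt_li] := leqP i l; first by rewrite B0 ?mul0r.
rewrite (lower_entry0 VT) ?mulr0 // ltn_neqAle lj /=.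
by rewrite ij ltnS in lt_li.
Qed.

(** The characteristic polynomial of a strictly lower triangular matrix is a
    power of X; conclude by Cayley-Hamilton. *)
Lemma lower_subdiag1_nilpotent n (H : 'M[K]_n) :
  lower_subdiag1 H -> nilpotent H.
Proof.
move=> [H0 _]; apply/nilpotentP.
case: n H H0 => [|m] H H0; first by rewrite [LHS]thinmx0 [RHS]thinmx0.
have Ht : is_trig_mx H by apply/is_trig_mxP => i j /ltnW/H0.
have := Cayley_Hamilton H; rewrite char_poly_trig //.
under eq_bigr => i _ do rewrite H0 // subr0.
by rewrite prodr_const card_ord rmorphXn /= horner_mx_X.
Qed.

(** The nilpotency condition in the definition of [H_B] follows from the linear
    ones. *)
Lemma H_BE n (H : 'M[K]_n) : H_B K n H <-> lower_subdiag1 H.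
Proof.
split=> [[_ H0 H1]|HH] //.
by split; [exact: lower_subdiag1_nilpotent | exact: HH.1 | exact: HH.2].
Qed.

(** From k(A) = U L and A k(A) = k(A) J one gets A U L = U L J, that is
    U^-1 A U = L J L^-1; the converse is the behaviour of k under
    conjugation. *)
Lemma H_B_saturationP m (A : 'M[K]_m.+1) :
  saturation (borel_conj K m.+1) (H_B K m.+1) A <->
  nilpotent A /\ trailing_minors (krylov A) != 0.
Proof.
split.
  move=> [H HB] [g gB <-]; have [Hnil _ _] := HB; split.
    exact: conj_act_stable.
  rewrite [act _]/= krylov_conj // scalemxAl; apply: trailing_minors_UL.
    by apply: borelZ => //; apply: borel_diag_neq0; apply: borelV.
  by apply: krylov_lower_subdiag1; apply/H_BE.
move=> [Anil] /UL_decomposition[U [L [UB LT eK]]].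
have LU := lower_unitriangular_unit LT; have [UU _] := UB.
have /nilpotentP A0 := Anil.
pose X := conj_act (invmx U) A.
have eX : X = L *m shift_mx K m.+1 *m invmx L.
  apply: (can_inj (mulmxK LU)); rewrite mulmxKV //.
  rewrite /X /conj_act invmxK -(mulmxA _ U L) -eK -mulmxA mulmx_krylov // eK.
  by rewrite -mulmxA mulKmx.
exists X; first by apply/H_BE; rewrite eX; apply: lower_subdiag1_conj_shift.
exists U => //; rewrite [act _]/= /X -conj_actM //; last exact: borelV.
by rewrite mulmxV // conj_act1.
Qed.

(** The multiple T = c g of g satisfies k(H') = T k(H), so T is lower
    unitriangular as well as upper triangular; thus T = 1, while T H = H' T
    because T is proportional to g. *)
Lemma borel_conj_subdiag1_inj m (H H' : 'M[K]_m.+1) (g : 'M[K]_m.+1) :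
  lower_subdiag1 H -> lower_subdiag1 H' -> borel_set g ->
  conj_act g H = H' -> H = H'.
Proof.
move=> HH HH' gB eH'; have [gU _] := gB.
have KT := krylov_lower_subdiag1 HH; have KT' := krylov_lower_subdiag1 HH'.
set T := invmx g 0 0 *: g.
have c0 : invmx g 0 0 != 0 by apply: borel_diag_neq0; apply: borelV.
have [_ Tu] : borel_set T by apply: borelZ.
have eK : krylov H' = T *m krylov H by rewrite -eH' krylov_conj // scalemxAl.
have eT : T = krylov H' *m invmx (krylov H).
  by rewrite eK mulmxK // lower_unitriangular_unit.
have T1 : T = 1%:M.
  apply: upper_lower_unitriangular => //; rewrite eT.
  by apply: lower_unitriangularM => //; apply: lower_unitriangularV.
have : T *m H = H' *m T.
  by rewrite /T -scalemxAl -scalemxAr -eH' /conj_act mulmxKV.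
by rewrite T1 mulmx1 mul1mx.
Qed.

(** The direction space is the kernel of the projection onto the entries with
    i <= j + 1, and the shift matrix is the base point. *)
Lemma H_B_affine_space n : affine_space (H_B K n).
Proof.
pose f (M : 'M[K]_n) : 'M[K]_n := \matrix_(i, j) (M i j *+ (i <= j.+1)%N).
have f_lin : linear f.
  move=> a M N; apply/matrixP => i j; rewrite !mxE.
  by case: (i <= _)%N; rewrite // !mulr0n mulr0 addr0.
pose fL := GRing.isLinear.Build _ _ _ _ f f_lin.
pose F : {linear 'M[K]_n -> 'M[K]_n} := HB.pack f fL.
exists (shift_mx K n), (lker (linfun F)).
have kerE H : (H - shift_mx K n \in lker (linfun F)) <-> lower_subdiag1 H.
  rewrite memv_ker lfunE /=; split=> [/eqP/matrixP H0|[H0 H1]].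
    split=> i j ij; have := H0 i j; rewrite !mxE.
      rewrite (leq_trans ij) // (ltn_eqF (leq_ltn_trans ij _)) //.
      by rewrite mulr1n subr0.
    by rewrite ij leqnn eqxx => /eqP; rewrite mulr1n subr_eq0 => /eqP.
  apply/eqP/matrixP => i j; rewrite !mxE.
  case: (ltngtP i j.+1) => [lt_ij|//|ij]; last by rewrite H1 // subrr.
  by rewrite H0 // subrr.
by apply/seteqP; split=> H /=; [move/H_BE/kerE | move/kerE/H_BE].
Qed.

Lemma H_B_saturation_open n :
  open_in (points (nilpotent_variety K n))
          (saturation (borel_conj K n) (H_B K n)).
Proof.
case: n => [|m].
  (* There is no first basis vector when n = 0; the space is then a point. *)
  exists set0.
    exists setT; apply/seteqP; split=> // A /= /(_ 1 I) /eqP.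
    by rewrite rmorph1 oner_eq0.
  rewrite setD0; apply/seteqP; split=> A.
    by move=> [H HB] [g gB <-]; apply: conj_act_stable => //; case: HB.
  move=> Anil; exists A; first by split=> // [] [].
  by exists 1%:M; [exact: borel1 | exact: conj_act1].
exists [set A | trailing_minors (krylov A) = 0].
  exists [set trailing_minors (krylov (generic_mx K m.+1))].
  have E (A : 'M[K]_m.+1) :
      (trailing_minors (krylov (generic_mx K m.+1))).@[mx_coords A]
      = trailing_minors (krylov A).
    by rewrite -map_trailing_minors -map_krylov meval_generic_mx.
  apply/seteqP; split=> A /=; first by move=> A0 _ ->; rewrite E.
  by move=> /(_ _ erefl); rewrite E.
apply/seteqP; split=> A.
  by move/H_B_saturationP => [Anil /eqP].
by move=> [Anil A0]; apply/H_B_saturationP; split=> //; apply/eqP.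
Qed.

Lemma H_B_generic_normal_form n :
  generic_normal_form (borel_conj K n) (H_B K n).
Proof.
split; [by move=> H [] | exact: H_B_saturation_open |].
move=> H H' HB HB' neqH eq_orb; apply: neqH.
case: n H H' HB HB' eq_orb => [|m] H H' HB HB' eq_orb.
  by rewrite [LHS]thinmx0 [RHS]thinmx0.
have [g gB eH'] : Defs.orbit (borel_conj K m.+1) H H'.
  rewrite eq_orb; exists 1%:M; first exact: borel1.
  by apply: conj_act1; case: HB'.
by apply: borel_conj_subdiag1_inj gB eH'; apply/H_BE.
Qed.

End NormalForm.

Theorem corollary4p4 (R : realType) (n : nat) :
  affine_space (H_B R[i] n) /\
  generic_normal_form (borel_conj R[i] n) (H_B R[i] n).
Proof.
by split; [exact: H_B_affine_space | exact: H_B_generic_normal_form].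
Qed.
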